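(* The Degasperis-Procesi equation $$m_t=-(m_x u+3\,m\,u_x),\qquad m=u-u_{xx},$$ cannot be realized as an Euler equation on $\mathrm{Diff}^\infty(\mathbb{S}^1)$ for any regular inertia operator: there is no $A\in\mathcal{L}_{is}^{sym}(C^\infty(\mathbb{S}^1))$ such that this equation is the Euler equation on $\mathrm{Diff}^\infty(\mathbb{S}^1)$ with respect to $\rho_A$.
   Context: $\mathbb{S}^1=\mathbb{R}/2\pi\mathbb{Z}$, and $C^\infty(\mathbb{S}^1)$ is the Fréchet space of real-valued smooth ($2\pi$-periodic) functions; subscripts $x$ and $t$ denote derivatives. $\mathrm{Diff}^\infty(\mathbb{S}^1)$ is the group of smooth orientation-preserving diffeomorphisms of $\mathbb{S}^1$, whose Lie algebra is identified with $C^\infty(\mathbb{S}^1)$ with bracket $[u,v]=u_xv-uv_x$; write $\mathrm{ad}_u v=[u,v]$. $\mathcal{L}_{is}^{sym}(C^\infty(\mathbb{S}^1))$ is the set of all continuous linear isomorphisms $A$ of $C^\infty(\mathbb{S}^1)$ onto itself that are symmetric with respect to the $L_2(\mathbb{S}^1)$ inner product, i.e. $\int_{\mathbb{S}^1}(Au)v\,dx=\int_{\mathbb{S}^1}u(Av)\,dx$ for all $u,v$. Such an $A$ is called a regular inertia operator on $\mathrm{Diff}^\infty(\mathbb{S}^1)$ (no positivity is required). It induces the right-invariant metric $\rho_A$ whose value at the identity is $\rho_A(u,v)=\int_{\mathbb{S}^1}(Au)\,v\,dx$. Let $(\mathrm{ad}_u)^*$ be the adjoint of $\mathrm{ad}_u$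 with respect to $\rho_A$, i.e. $\rho_A((\mathrm{ad}_u)^*v,w)=\rho_A(v,\mathrm{ad}_u w)$ for all $w\in C^\infty(\mathbb{S}^1)$, and let $B(u,v)=\frac12\big[(\mathrm{ad}_u)^*v+(\mathrm{ad}_v)^*u\big]$ be the Christoffel operator. The Euler equation on $\mathrm{Diff}^\infty(\mathbb{S}^1)$ with respect to $\rho_A$ is $u_t=-B(u,u)$. With $L=\mathrm{id}-\partial_x^2$ (which is invertible on $C^\infty(\mathbb{S}^1)$), the Degasperis-Procesi equation reads $u_t=-L^{-1}\big(3(Lu)u_x+u(Lu)_x\big)$. Saying that it is the Euler equation with respect to $\rho_A$ means that these two evolution equations have the same right-hand side, i.e. $B(u,u)=L^{-1}\big(3(Lu)u_x+u(Lu)_x\big)$ for all $u\in C^\infty(\mathbb{S}^1)$. *)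

(* Defs.v *)
From Stdlib Require Import Reals Lra Lia.
From Stdlib Require Import ClassicalEpsilon FunctionalExtensionality ProofIrrelevance.
From Coquelicot Require Import Coquelicot.
Open Scope R_scope.

Definition smooth (f : R -> R) : Prop := forall n x, ex_derive_n f n x.

Definition periodic (f : R -> R) : Prop := forall x, f (x + 2 * PI) = f x.

(* C^oo(S^1), S^1 = R/2piZ, as the 2pi-periodic smooth functions on R. *)
Record Cinf : Type := mkCinf {
  cfun :> R -> R;
  cfun_smooth : smooth cfun;
  cfun_periodic : periodic cfun }.

Lemma Cinf_ext (u v : Cinf) : (forall x, u x = v x) -> u = v.
Proof.
  destruct u as [f sf pf], v as [g sg pg]; cbn; intro H.
  assert (E : f = g) by (apply functional_extensionality; exact H).
  subst g; f_equal; apply proof_irrelevance.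
Qed.

Lemma Derive_n_S_Derive f n x : Derive_n f (S n) x = Derive_n (Derive f) n x.
Proof.
  change (Derive f) with (Derive_n f 1).
  now rewrite Derive_n_comp, PeanoNat.Nat.add_1_r.
Qed.

Lemma ex_derive_n_S f n x :
  ex_derive f x -> ex_derive_n (Derive f) n x -> ex_derive_n f (S n) x.
Proof.
  destruct n as [|n]; intros H1 H2; [exact H1|].
  cbn in H2; apply (ex_derive_ext (Derive_n (Derive f) n)); [|exact H2].
  intro t; symmetry; apply Derive_n_S_Derive.
Qed.

Lemma smooth_ex_derive f : smooth f -> forall x, ex_derive f x.
Proof. intros H x; exact (H 1%nat x). Qed.

Lemma smooth_continuous f : smooth f -> forall x, continuous f x.
Proof. intros H x; apply (ex_derive_continuous f), smooth_ex_derive, H. Qed.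

Lemma smooth_Derive f : smooth f -> smooth (Derive f).
Proof.
  intros H [|n] x; [exact I|].
  cbn; apply (ex_derive_ext (Derive_n f (S n))).
  - intro t; apply Derive_n_S_Derive.
  - exact (H (S (S n)) x).
Qed.

Lemma smooth_ext f g : (forall x, f x = g x) -> smooth f -> smooth g.
Proof. intros E H n x; exact (ex_derive_n_ext f g n x E (H n x)). Qed.

Lemma smooth_const c : smooth (fun _ => c).
Proof.
  intro n; revert c; induction n as [|n IH]; intros c x; [exact I|].
  apply ex_derive_n_S; [apply ex_derive_const|].
  apply (ex_derive_n_ext (fun _ => 0)); [|apply IH].
  intro t; symmetry; apply Derive_const.
Qed.

Lemma smooth_plus f g : smooth f -> smooth g -> smooth (fun x => f x + g x).
Proof.
  intros Hf Hg n x; apply ex_derive_n_plus; apply filter_forall; intros; auto.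
Qed.

Lemma smooth_scal c f : smooth f -> smooth (fun x => c * f x).
Proof. intros Hf n x; apply ex_derive_n_scal_l, Hf. Qed.

Lemma smooth_mult f g : smooth f -> smooth g -> smooth (fun x => f x * g x).
Proof.
  intros Hf Hg n; revert f g Hf Hg.
  induction n as [n IH] using (well_founded_induction Wf_nat.lt_wf).
  intros f g Hf Hg x; destruct n as [|n]; [exact I|].
  apply ex_derive_n_S.
  - apply (ex_derive_mult f g); now apply smooth_ex_derive.
  - apply (ex_derive_n_ext (fun x => Derive f x * g x + f x * Derive g x)).
    + intro t; symmetry; apply Derive_mult; now apply smooth_ex_derive.
    + apply ex_derive_n_plus; apply filter_forall; intros y k Hk;
        apply IH; auto using smooth_Derive; lia.
Qed.

Lemma periodic_Derive f : smooth f -> periodic f -> periodic (Derive f).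
Proof.
  intros Hs Hp x.
  rewrite <- (Derive_ext (fun t => f (t + 2 * PI)) f x Hp).
  symmetry; apply is_derive_unique.
  replace (Derive f (x + 2 * PI)) with (1 * Derive f (x + 2 * PI)) by ring.
  apply (is_derive_comp f (fun t => t + 2 * PI)).
  - apply Derive_correct, smooth_ex_derive, Hs.
  - auto_derive; auto.
Qed.

Program Definition czero : Cinf := mkCinf (fun _ => 0) (smooth_const 0) _.
Next Obligation. intro x; reflexivity. Qed.

Program Definition cadd (u v : Cinf) : Cinf :=
  mkCinf (fun x => u x + v x)
    (smooth_plus u v (cfun_smooth u) (cfun_smooth v)) _.
Next Obligation. intro x; cbn; now rewrite !cfun_periodic. Qed.

Program Definition cscal (k : R) (u : Cinf) : Cinf :=
  mkCinf (fun x => k * u x) (smooth_scal k u (cfun_smooth u)) _.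
Next Obligation. intro x; cbn; now rewrite !cfun_periodic. Qed.

Program Definition cmul (u v : Cinf) : Cinf :=
  mkCinf (fun x => u x * v x)
    (smooth_mult u v (cfun_smooth u) (cfun_smooth v)) _.
Next Obligation. intro x; cbn; now rewrite !cfun_periodic. Qed.

Definition cderiv (u : Cinf) : Cinf :=
  mkCinf (Derive u) (smooth_Derive u (cfun_smooth u))
    (periodic_Derive u (cfun_smooth u) (cfun_periodic u)).

Declare Scope cinf_scope.
Delimit Scope cinf_scope with cinf.
Bind Scope cinf_scope with Cinf.
Notation "u + v" := (cadd u v) : cinf_scope.
Notation "u * v" := (cmul u v) : cinf_scope.
Notation "k *: u" := (cscal k%R u) (at level 40, left associativity) : cinf_scope.
Notation "- u" := (cscal (-1)%R u) : cinf_scope.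
Notation "u - v" := (cadd u (cscal (-1)%R v)) : cinf_scope.

(* Neighbourhoods for the Frechet topology given by the seminorms
   sup_x |u^(k)(x)|, k = 0, 1, 2, ... *)
Definition cinf_nbhs (u : Cinf) (P : Cinf -> Prop) : Prop :=
  exists (N : nat) (eps : posreal), forall v : Cinf,
    (forall k x, (k <= N)%nat -> Rabs (Derive_n v k x - Derive_n u k x) < eps) ->
    P v.

#[global] Instance cinf_nbhs_filter (u : Cinf) : ProperFilter' (cinf_nbhs u).
Proof.
  split; [|split].
  - intros (N & eps & H); apply (H u); intros k x _.
    rewrite Rminus_diag, Rabs_R0; apply cond_pos.
  - now exists O, (mkposreal 1 Rlt_0_1).
  - intros P Q (N & e & HP) (M & d & HQ).
    assert (Hm : 0 < Rmin e d) by (apply Rmin_pos; apply cond_pos).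
    exists (max N M), (mkposreal _ Hm); cbn; intros v Hv; split.
    + apply HP; intros k x Hk; apply Rlt_le_trans with (2 := Rmin_l e d).
      apply Hv; lia.
    + apply HQ; intros k x Hk; apply Rlt_le_trans with (2 := Rmin_r e d).
      apply Hv; lia.
  - intros P Q HPQ (N & e & HP); exists N, e; auto.
Qed.

Definition cinf_continuous (A : Cinf -> Cinf) : Prop :=
  forall u, filterlim A (cinf_nbhs u) (cinf_nbhs (A u)).

Definition cinf_linear (A : Cinf -> Cinf) : Prop :=
  (forall u v, A (u + v)%cinf = (A u + A v)%cinf) /\
  (forall k u, A (k *: u)%cinf = (k *: A u)%cinf).

Definition cinf_bijective (A : Cinf -> Cinf) : Prop :=
  forall v, exists! u, A u = v.

Definition L2 (u v : Cinf) : R := RInt (fun x => u x * v x) 0 (2 * PI).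

(* A in L_is^sym(C^oo(S^1)); continuity of the inverse is not required, being
   automatic by the open mapping theorem. *)
Definition regular_inertia (A : Cinf -> Cinf) : Prop :=
  cinf_linear A /\ cinf_continuous A /\ cinf_bijective A /\
  (forall u v, L2 (A u) v = L2 u (A v)).

Definition rho (A : Cinf -> Cinf) (u v : Cinf) : R := L2 (A u) v.

Definition ad (u v : Cinf) : Cinf := (cderiv u * v - u * cderiv v)%cinf.

Definition is_ad_adjoint (A : Cinf -> Cinf) (u v z : Cinf) : Prop :=
  forall w, rho A z w = rho A v (ad u w).

(* (ad_u)^* v; for A regular, ad_star_spec and ad_star_unique below show that
   it exists and is determined by its defining property. *)
Definition ad_star (A : Cinf -> Cinf) (u v : Cinf) : Cinf :=
  epsilon (inhabits czero) (is_ad_adjoint A u v).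

Definition christoffel (A : Cinf -> Cinf) (u v : Cinf) : Cinf :=
  ((1 / 2) *: (ad_star A u v + ad_star A v u))%cinf.

Definition euler_rhs (A : Cinf -> Cinf) (u : Cinf) : Cinf :=
  (- christoffel A u u)%cinf.

Definition Lop (u : Cinf) : Cinf := (u - cderiv (cderiv u))%cinf.

(* L^-1; it is a two-sided inverse of L by Lop_Linv and Linv_Lop below. *)
Definition Linv (m : Cinf) : Cinf :=
  epsilon (inhabits czero) (fun u => Lop u = m).

Definition dp_rhs (u : Cinf) : Cinf :=
  (- Linv (3 *: (Lop u * cderiv u) + u * cderiv (Lop u)))%cinf.

(* u_t = euler_rhs A u and u_t = dp_rhs u are the same evolution equation. *)
Definition dp_is_euler (A : Cinf -> Cinf) : Prop :=
  forall u, euler_rhs A u = dp_rhs u.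

Lemma cinf_is_derive (u : Cinf) x : is_derive u x (cderiv u x).
Proof. apply Derive_correct, smooth_ex_derive, cfun_smooth. Qed.

Lemma cinf_continuous_at (u : Cinf) x : continuous u x.
Proof. apply smooth_continuous, cfun_smooth. Qed.

Lemma cinf_ex_RInt (u : Cinf) a b : ex_RInt u a b.
Proof. apply (ex_RInt_continuous u); intros; apply cinf_continuous_at. Qed.

Lemma cderiv_add u v : cderiv (u + v)%cinf = (cderiv u + cderiv v)%cinf.
Proof.
  apply Cinf_ext; intro x; apply is_derive_unique.
  apply (is_derive_plus u v); apply cinf_is_derive.
Qed.

Lemma cderiv_scal k u : cderiv (k *: u)%cinf = (k *: cderiv u)%cinf.
Proof.
  apply Cinf_ext; intro x; apply is_derive_unique.
  apply (is_derive_scal u); apply cinf_is_derive.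
Qed.

Lemma cderiv_mul u v :
  cderiv (u * v)%cinf = (cderiv u * v + u * cderiv v)%cinf.
Proof.
  apply Cinf_ext; intro x; apply is_derive_unique.
  apply (is_derive_mult u v); [apply cinf_is_derive | apply cinf_is_derive |].
  exact Rmult_comm.
Qed.

Lemma RInt_cderiv (u : Cinf) : RInt (cderiv u) 0 (2 * PI) = 0.
Proof.
  transitivity (u (2 * PI) - u 0);
    [|rewrite <- (cfun_periodic u 0), Rplus_0_l; apply Rminus_diag].
  apply RInt_Derive.
  - intros; apply smooth_ex_derive, cfun_smooth.
  - intros; apply (cinf_continuous_at (cderiv u)).
Qed.

Lemma zero_derive_const (f : R -> R) :
  (forall x, is_derive f x 0) -> forall x y, f x = f y.
Proof.
  intros H x y; destruct (MVT_gen f x y (fun _ => 0)) as (c & _ & E).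
  - intros; apply H.
  - intros z _; apply derivable_continuous_pt; exists 0; apply is_derive_Reals, H.
  - lra.
Qed.

Lemma RInt_sqr_eq0 (u : Cinf) : L2 u u = 0 -> u = czero.
Proof.
  unfold L2; intro H0.
  set (G := fun x => RInt (u * u)%cinf 0 x).
  assert (HG : forall x, is_derive G x (u x * u x)).
  { intro x; apply (is_derive_RInt (u * u)%cinf G 0 x).
    - apply filter_forall; intro b; apply (RInt_correct (u * u)%cinf), cinf_ex_RInt.
    - apply (cinf_continuous_at (u * u)%cinf). }
  assert (Gper : forall x, G (x + 2 * PI) = G x).
  { intro x.
    assert (E : G (x + 2 * PI) - G x = G (0 + 2 * PI) - G 0).
    { apply (zero_derive_const (fun x => G (x + 2 * PI) - G x)); clear x; intro x.
      replace 0 with (minus (1 * (u (x + 2 * PI) * u (x + 2 * PI))) (u x * u x)).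
      - apply (is_derive_minus (fun x => G (x + 2 * PI)) G); [|apply HG].
        apply (is_derive_comp G (fun t => t + 2 * PI)); [apply HG|].
        auto_derive; auto.
      - rewrite cfun_periodic; unfold minus, plus, opp; cbn; ring. }
    assert (G0 : G 0 = 0) by apply (RInt_point 0 (u * u)%cinf).
    assert (G1 : G (2 * PI) = 0) by exact H0.
    rewrite Rplus_0_l, G0, G1 in E; lra. }
  assert (Gmono : forall x y, x <= y -> G x <= G y).
  { intros x y Hxy; destruct (MVT_gen G x y (fun x => u x * u x)) as (c & _ & E).
    - intros; apply HG.
    - intros z _; apply derivable_continuous_pt.
      exists (u z * u z); apply is_derive_Reals, HG.
    - assert (0 <= u c * u c) by apply Rle_0_sqr; nra. }
  assert (Gpern : forall n x, G (x + INR n * (2 * PI)) = G x).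
  { induction n as [|n IH]; intro x; [change (INR 0) with 0; f_equal; ring|].
    replace (x + INR (S n) * (2 * PI)) with (x + INR n * (2 * PI) + 2 * PI)
      by (rewrite S_INR; ring).
    rewrite Gper; apply IH. }
  assert (Gle : forall x y, x <= y -> G y = G x).
  { intros x y Hxy; apply Rle_antisym; [|now apply Gmono].
    pose proof PI_RGT_0 as Hpi.
    destruct (INR_unbounded ((y - x) / (2 * PI))) as [n Hn].
    rewrite <- (Gpern n x); apply Gmono.
    apply Rmult_lt_compat_r with (r := 2 * PI) in Hn; [|lra].
    unfold Rdiv in Hn; rewrite Rmult_assoc, Rinv_l in Hn; lra. }
  apply Cinf_ext; intro x; cbn.
  apply Rsqr_0_uniq; unfold Rsqr.
  rewrite <- (is_derive_unique _ _ _ (HG x)).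
  rewrite (Derive_ext G (fun _ => G 0)); [apply Derive_const|].
  intro t; destruct (Rle_or_lt 0 t); [|symmetry]; apply Gle; lra.
Qed.

Lemma L2_sub u v w : L2 (u - v)%cinf w = L2 u w - L2 v w.
Proof.
  unfold L2; rewrite <- (RInt_minus (V := R_CompleteNormedModule)).
  - apply RInt_ext; intros; unfold minus, plus, opp; cbn; ring.
  - apply (cinf_ex_RInt (u * w)%cinf).
  - apply (cinf_ex_RInt (v * w)%cinf).
Qed.

Lemma L2_inj u v : (forall w, L2 u w = L2 v w) -> u = v.
Proof.
  intro H; assert (E : (u - v)%cinf = czero).
  { apply RInt_sqr_eq0; rewrite L2_sub, H; ring. }
  apply Cinf_ext; intro x.
  assert (E' := f_equal (fun f : Cinf => f x) E); cbn in E'; lra.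
Qed.

Lemma L2_ad f u w :
  L2 f (ad u w) = L2 (2 *: (f * cderiv u) + u * cderiv f)%cinf w.
Proof.
  apply Rminus_diag_uniq.
  transitivity (- RInt (cderiv (f * u * w)%cinf) 0 (2 * PI));
    [|rewrite RInt_cderiv; ring].
  unfold L2; rewrite <- (RInt_minus (V := R_CompleteNormedModule)),
    <- (RInt_opp (V := R_CompleteNormedModule)).
  - apply RInt_ext; intros x _.
    rewrite !cderiv_mul; unfold minus, plus, opp; cbn; ring.
  - apply cinf_ex_RInt.
  - apply (cinf_ex_RInt (f * ad u w)%cinf).
  - apply (cinf_ex_RInt ((2 *: (f * cderiv u) + u * cderiv f) * w)%cinf).
Qed.

Lemma ad_star_spec A u v :
  regular_inertia A -> is_ad_adjoint A u v (ad_star A u v).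
Proof.
  intros (_ & _ & bij & _).
  apply (epsilon_spec (inhabits czero) (is_ad_adjoint A u v)).
  destruct (bij (2 *: (A v * cderiv u) + u * cderiv (A v))%cinf) as (z & Hz & _).
  exists z; intro w; unfold rho; now rewrite Hz, L2_ad.
Qed.

Lemma ad_star_unique A u v z :
  regular_inertia A -> is_ad_adjoint A u v z -> z = ad_star A u v.
Proof.
  intros rA Hz.
  assert (E : A z = A (ad_star A u v)).
  { apply L2_inj; intro w; fold (rho A z w) (rho A (ad_star A u v) w).
    rewrite (Hz w); symmetry; now apply ad_star_spec. }
  destruct rA as (_ & _ & bij & _), (bij (A z)) as (y & _ & Hy).
  now rewrite <- (Hy z), <- (Hy (ad_star A u v)).
Qed.

Lemma exp_2PI_neq1 c : c <> 0 -> exp (c * (2 * PI)) - 1 <> 0.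
Proof.
  intros Hc E; apply Hc; pose proof PI_RGT_0.
  assert (c * (2 * PI) = 0) by (apply exp_inv; rewrite exp_0; lra).
  nra.
Qed.

Lemma first_order_uniq (g : R -> R) c : c <> 0 ->
  (forall x, is_derive g x (- c * g x)) -> g (2 * PI) = g 0 -> forall x, g x = 0.
Proof.
  intros Hc Hg H0.
  assert (E : forall x, exp (c * x) * g x = g 0).
  { intro x; transitivity (exp (c * 0) * g 0);
      [|rewrite Rmult_0_r, exp_0; ring].
    apply (zero_derive_const (fun x => exp (c * x) * g x)); clear x; intro x.
    replace 0 with (c * exp (c * x) * g x + exp (c * x) * (- c * g x)) by ring.
    apply (is_derive_mult (fun x => exp (c * x)) g); [|apply Hg|exact Rmult_comm].
    auto_derive; auto; ring. }
  assert (Z : g 0 = 0).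
  { pose proof (E (2 * PI)) as E1; rewrite H0 in E1.
    destruct (Rmult_integral (exp (c * (2 * PI)) - 1) (g 0)) as [F|F];
      [lra | now apply exp_2PI_neq1 in F | exact F]. }
  intro x; pose proof (E x) as Ex; rewrite Z in Ex.
  destruct (Rmult_integral _ _ Ex) as [F|F]; [|exact F].
  pose proof (exp_pos (c * x)); lra.
Qed.

Lemma first_order_ex (m : Cinf) c : c <> 0 ->
  exists p : Cinf, (cderiv p + c *: p)%cinf = m.
Proof.
  intro Hc.
  set (h := fun y => exp (c * y) * m y).
  assert (hc : forall x, continuous h x).
  { intro x; apply (ex_derive_continuous h), (ex_derive_mult (fun y => exp (c * y)) m).
    - auto_derive; auto.
    - eexists; apply cinf_is_derive. }
  set (F := fun x => RInt h 0 x).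
  assert (HF : forall x, is_derive F x (h x)).
  { intro x; apply (is_derive_RInt h F 0 x); [|apply hc].
    apply filter_forall; intro b; apply (RInt_correct h).
    apply (ex_RInt_continuous h); intros; apply hc. }
  set (a := F (2 * PI) / (exp (c * (2 * PI)) - 1)).
  set (p := fun x => exp (- (c * x)) * (a + F x)).
  assert (Hp : forall x, is_derive p x (m x - c * p x)).
  { intro x.
    replace (m x - c * p x) with
      (- c * exp (- (c * x)) * (a + F x) + exp (- (c * x)) * (0 + h x)).
    - apply (is_derive_mult (fun x => exp (- (c * x))) (fun x => a + F x));
        [| |exact Rmult_comm].
      + auto_derive; auto; ring.
      + apply (is_derive_plus (fun _ => a) F);
          [exact (is_derive_const a x) | apply HF].
    - unfold p, h; rewrite exp_Ropp; field_simplify; [ring| |];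
        apply Rgt_not_eq, exp_pos. }
  assert (ps : smooth p).
  { intro n; induction n as [n IH] using (well_founded_induction Wf_nat.lt_wf).
    intro x; destruct n as [|n]; [exact I|].
    apply ex_derive_n_S; [eexists; apply Hp|].
    apply (ex_derive_n_ext (fun x => m x + - c * p x)).
    - intro t; rewrite (is_derive_unique _ _ _ (Hp t)); ring.
    - apply ex_derive_n_plus; apply filter_forall; intros y k Hk.
      + apply cfun_smooth.
      + apply ex_derive_n_scal_l, IH; lia. }
  assert (p0 : p (0 + 2 * PI) = p 0).
  { unfold p; rewrite Rplus_0_l, Rmult_0_r, Ropp_0, exp_0.
    replace (F 0) with 0 by (symmetry; apply (RInt_point 0 h)).
    unfold a; rewrite exp_Ropp; field; split.
    - now apply exp_2PI_neq1.
    - apply Rgt_not_eq, exp_pos. }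
  assert (pq : forall x, is_derive (fun x => p (x + 2 * PI)) x
                           (m x - c * p (x + 2 * PI))).
  { intro x; rewrite <- (cfun_periodic m x).
    replace (m (x + 2 * PI) - c * p (x + 2 * PI))
      with (1 * (m (x + 2 * PI) - c * p (x + 2 * PI))) by ring.
    apply (is_derive_comp p (fun t => t + 2 * PI)); [apply Hp|].
    auto_derive; auto. }
  assert (pp : periodic p).
  { set (g := fun x => exp (c * x) * (p (x + 2 * PI) - p x)).
    assert (E : forall x, g x = g 0).
    { intro x; apply zero_derive_const; clear x; intro x.
      replace 0 with (c * exp (c * x) * (p (x + 2 * PI) - p x) +
        exp (c * x) * ((m x - c * p (x + 2 * PI)) - (m x - c * p x))) by ring.
      apply (is_derive_mult (fun x => exp (c * x))
               (fun x => p (x + 2 * PI) - p x)); [| |exact Rmult_comm].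
      - auto_derive; auto; ring.
      - apply (is_derive_minus (fun x => p (x + 2 * PI)) p); auto. }
    intro x; specialize (E x); unfold g in E.
    rewrite p0, Rminus_diag, Rmult_0_r in E.
    destruct (Rmult_integral _ _ E) as [G|G]; [|lra].
    pose proof (exp_pos (c * x)); lra. }
  exists (mkCinf p ps pp); apply Cinf_ext; intro x; cbn.
  rewrite (is_derive_unique _ _ _ (Hp x)); ring.
Qed.

Lemma Lop_bijective : cinf_bijective Lop.
Proof.
  intro m.
  destruct (first_order_ex m 1) as [p Hp]; [lra|].
  destruct (first_order_ex (- p)%cinf (-1)) as [u Hu]; [lra|].
  assert (Lu : Lop u = m).
  { subst m; assert (Ep : p = (u - cderiv u)%cinf).
    { apply Cinf_ext; intro x.
      assert (E := f_equal (fun f : Cinf => f x) Hu); cbn in E |- *; lra. }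
    rewrite Ep, !cderiv_add, !cderiv_scal; apply Cinf_ext; intro x; cbn; ring. }
  exists u; split; [exact Lu|].
  intros v Hv; set (d := (v - u)%cinf).
  assert (HL : forall x, d x - cderiv (cderiv d) x = 0).
  { intro x; assert (E := f_equal (fun f : Cinf => f x) (eq_trans Hv (eq_sym Lu))).
    unfold d; rewrite !cderiv_add, !cderiv_scal; cbn in *; lra. }
  assert (per : forall f : Cinf, f (2 * PI) = f 0).
  { intro f; rewrite <- (cfun_periodic f 0); f_equal; ring. }
  assert (Hq : forall x, (d - cderiv d)%cinf x = 0).
  { apply (first_order_uniq _ 1); [lra| |apply per].
    intro x; generalize (cinf_is_derive (d - cderiv d)%cinf x).
    rewrite !cderiv_add, !cderiv_scal.
    replace (- (1) * (d - cderiv d)%cinf x)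
      with ((cderiv d + -1 *: cderiv (cderiv d))%cinf x); [easy|].
    specialize (HL x); cbn in *; lra. }
  assert (Hd : forall x, d x = 0).
  { apply (first_order_uniq _ (-1)); [lra| |apply per].
    intro x; replace (- -1 * d x) with (cderiv d x); [apply cinf_is_derive|].
    specialize (Hq x); cbn in *; lra. }
  apply Cinf_ext; intro x; specialize (Hd x); cbn in Hd; lra.
Qed.

Lemma Lop_Linv m : Lop (Linv m) = m.
Proof.
  unfold Linv; apply (epsilon_spec (inhabits czero) (fun u => Lop u = m)).
  destruct (Lop_bijective m) as (u & Hu & _); now exists u.
Qed.

Lemma Linv_Lop u : Linv (Lop u) = u.
Proof.
  destruct (Lop_bijective (Lop u)) as (w & _ & Hw).
  transitivity w; [symmetry; apply Hw, Lop_Linv | now apply Hw].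
Qed.

(* With m = u - u_xx, the equation u_t = dp_rhs u reads m_t = -(m_x u + 3 m u_x). *)
Lemma Lop_dp_rhs u :
  Lop (dp_rhs u) =
  (- (cderiv (Lop u) * u + 3 *: (Lop u * cderiv u)))%cinf.
Proof.
  unfold dp_rhs; set (f := (3 *: (Lop u * cderiv u) + u * cderiv (Lop u))%cinf).
  transitivity (- Lop (Linv f))%cinf.
  - unfold Lop; rewrite !cderiv_scal; apply Cinf_ext; intro x; cbn; ring.
  - rewrite Lop_Linv; apply Cinf_ext; intro x; cbn; ring.
Qed.

(* Main.v *)
From Stdlib Require Import Reals Lra.
From Coquelicot Require Import Coquelicot.
Require Import Defs.
Open Scope R_scope.

(** The idea is to find the Fourier matrix of [A] from the equation linearised
    at the constant function 1, and then to see that the equation fails at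
    [u = cos x].

    If the two right-hand sides agree, then [A z = 2 (A u) u_x + u (A u)_x]
    whenever [L z = 3 (L u) u_x + u (L u)_x] ([dp_euler_identity]).  For
    [u = 1] this says that [A 1] is a constant [c], nonzero because [A] is
    injective.  The part of the identity at [u = 1 + w] that is linear in [w]
    reads [A y = 2 c w_x + (A w)_x] with [L y = 3 w_x + (L w)_x]
    ([dp_euler_linearised]).  For [w = cos nx] and [w = sin nx] the function [y]
    is [w_x] multiplied by [(4 + n^2) / (1 + n^2)].  Pairing with the modes of
    frequency [k] and integrating by parts gives a two-by-two linear system for
    [<A cos nx, cos kx>] and [<A sin nx, sin kx>] ([inertia_matrix]).  On
    the coefficients that matter, it leaves only the values of [(2 c / 3) L].

    Now take [u = cos x], so [z = -(4/5) sin 2x], and pair the identity with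
    [sin 2x].  One side is [-(8/3) c pi] and the other is [-2 c pi], which forces
    [c = 0].

    Only finitely many Fourier coefficients enter, so neither convergence of
    Fourier series nor uniqueness for differential equations is called upon. *)

(** * The inner product and integration by parts *)

Lemma cinf_eq_at (u v : Cinf) : u = v -> forall x, u x = v x.
Proof. now intros ->. Qed.

Lemma L2_comm u v : L2 u v = L2 v u.
Proof. apply RInt_ext; intros; apply Rmult_comm. Qed.

Lemma L2_add_l u v w : L2 (u + v)%cinf w = L2 u w + L2 v w.
Proof.
  unfold L2; rewrite <- (RInt_plus (V := R_CompleteNormedModule)).
  - apply RInt_ext; intros; unfold plus; cbn; ring.
  - apply (cinf_ex_RInt (u * w)%cinf).
  - apply (cinf_ex_RInt (v * w)%cinf).
Qed.

Lemma L2_scal_l k u w : L2 (k *: u)%cinf w = k * L2 u w.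
Proof.
  unfold L2; rewrite <- (RInt_scal (V := R_CompleteNormedModule)).
  - apply RInt_ext; intros; unfold scal; cbn; unfold mult; cbn; ring.
  - apply (cinf_ex_RInt (u * w)%cinf).
Qed.

Lemma L2_add_r u v w : L2 w (u + v)%cinf = L2 w u + L2 w v.
Proof. now rewrite L2_comm, L2_add_l, !(L2_comm w). Qed.

Lemma L2_scal_r k u w : L2 w (k *: u)%cinf = k * L2 w u.
Proof. now rewrite L2_comm, L2_scal_l, (L2_comm w). Qed.

Lemma L2_cderiv_l u v : L2 (cderiv u) v = - L2 u (cderiv v).
Proof.
  assert (E : L2 (cderiv u) v + L2 u (cderiv v) = 0); [|lra].
  rewrite <- (RInt_cderiv (u * v)%cinf); unfold L2.
  rewrite <- (RInt_plus (V := R_CompleteNormedModule)).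
  - apply RInt_ext; intros; now rewrite cderiv_mul.
  - apply (cinf_ex_RInt (cderiv u * v)%cinf).
  - apply (cinf_ex_RInt (u * cderiv v)%cinf).
Qed.

(** * Fourier modes *)

(** The phase [b] and amplitude [p] make the family stable under
    differentiation, which is what the induction needs. *)
Lemma smooth_cos_affine p a b : smooth (fun x => p * cos (a * x + b)).
Proof.
  intro n; revert p b; induction n as [|n IH]; intros p b x; [exact I|].
  apply ex_derive_n_S; [auto_derive; auto|].
  apply (ex_derive_n_ext (fun x => (p * a) * cos (a * x + (b + PI / 2))));
    [|apply IH].
  intro t; symmetry; apply is_derive_unique; auto_derive; auto.
  replace (a * t + (b + PI / 2)) with (a * t + b + PI / 2) by ring.
  rewrite (cos_plus _ (PI / 2)), cos_PI2, sin_PI2; ring.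
Qed.

Definition one : Cinf := mkCinf (fun _ => 1) (smooth_const 1) (fun _ => eq_refl).

Lemma cos_mode_smooth n : smooth (fun x => cos (INR n * x)).
Proof.
  apply (smooth_ext (fun x => 1 * cos (INR n * x + 0)));
    [|apply smooth_cos_affine].
  intro x; rewrite Rplus_0_r; ring.
Qed.

Lemma cos_mode_periodic n : periodic (fun x => cos (INR n * x)).
Proof.
  intro x; rewrite <- (cos_period (INR n * x) n); f_equal; ring.
Qed.

Lemma sin_mode_smooth n : smooth (fun x => sin (INR n * x)).
Proof.
  apply (smooth_ext (fun x => -1 * cos (INR n * x + PI / 2)));
    [|apply smooth_cos_affine].
  intro x; rewrite cos_plus, cos_PI2, sin_PI2; ring.
Qed.

Lemma sin_mode_periodic n : periodic (fun x => sin (INR n * x)).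
Proof.
  intro x; rewrite <- (sin_period (INR n * x) n); f_equal; ring.
Qed.

Definition cos_mode n : Cinf :=
  mkCinf (fun x => cos (INR n * x)) (cos_mode_smooth n) (cos_mode_periodic n).

Definition sin_mode n : Cinf :=
  mkCinf (fun x => sin (INR n * x)) (sin_mode_smooth n) (sin_mode_periodic n).

Lemma cderiv_one : cderiv one = czero.
Proof. apply Cinf_ext; intro x; exact (Derive_const 1 x). Qed.

Lemma cderiv_cos_mode n : cderiv (cos_mode n) = ((- INR n) *: sin_mode n)%cinf.
Proof.
  apply Cinf_ext; intro x; apply is_derive_unique; cbn.
  auto_derive; auto; ring.
Qed.

Lemma cderiv_sin_mode n : cderiv (sin_mode n) = (INR n *: cos_mode n)%cinf.
Proof.
  apply Cinf_ext; intro x; apply is_derive_unique; cbn.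
  auto_derive; auto; ring.
Qed.

Lemma Lop_add u v : Lop (u + v)%cinf = (Lop u + Lop v)%cinf.
Proof.
  unfold Lop; rewrite !cderiv_add; apply Cinf_ext; intro x; cbn; ring.
Qed.

Lemma Lop_scal k u : Lop (k *: u)%cinf = (k *: Lop u)%cinf.
Proof.
  unfold Lop; rewrite !cderiv_scal; apply Cinf_ext; intro x; cbn; ring.
Qed.

Lemma Lop_one : Lop one = one.
Proof.
  unfold Lop; rewrite cderiv_one; apply Cinf_ext; intro x; cbn.
  rewrite Derive_const; ring.
Qed.

Lemma Lop_cos_mode n : Lop (cos_mode n) = ((1 + INR n ^ 2) *: cos_mode n)%cinf.
Proof.
  unfold Lop; rewrite cderiv_cos_mode, cderiv_scal, cderiv_sin_mode.
  apply Cinf_ext; intro x; cbn; ring.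
Qed.

Lemma Lop_sin_mode n : Lop (sin_mode n) = ((1 + INR n ^ 2) *: sin_mode n)%cinf.
Proof.
  unfold Lop; rewrite cderiv_sin_mode, cderiv_scal, cderiv_cos_mode.
  apply Cinf_ext; intro x; cbn; ring.
Qed.

Lemma L2_cos_sin_mode n : L2 (cos_mode (S n)) (cos_mode (S n)) = PI
  /\ L2 (sin_mode (S n)) (sin_mode (S n)) = PI.
Proof.
  set (m := S n); assert (Hm : INR m <> 0) by (apply not_0_INR; easy).
  assert (E : L2 (cos_mode m) (cos_mode m) = L2 (sin_mode m) (sin_mode m)).
  { pose proof (L2_cderiv_l (cos_mode m) (sin_mode m)) as H.
    rewrite cderiv_cos_mode, cderiv_sin_mode, L2_scal_l, L2_scal_r in H.
    apply Rmult_eq_reg_l with (INR m); [lra | exact Hm]. }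
  assert (S : L2 (cos_mode m) (cos_mode m) + L2 (sin_mode m) (sin_mode m)
              = 2 * PI).
  { unfold L2; rewrite <- (RInt_plus (V := R_CompleteNormedModule)).
    - rewrite (RInt_ext _ (fun _ => 1)).
      + rewrite RInt_const; unfold scal; cbn; unfold mult; cbn; ring.
      + intros x _; unfold plus; cbn -[INR].
        pose proof (sin2_cos2 (INR m * x)); unfold Rsqr in *; lra.
    - apply (cinf_ex_RInt (cos_mode m * cos_mode m)%cinf).
    - apply (cinf_ex_RInt (sin_mode m * sin_mode m)%cinf). }
  lra.
Qed.

(** Integrating by parts both ways gives [k C = n S] and [k S = n C] for the
    cosine and sine pairings [C] and [S]. *)
Lemma L2_modes_orthogonal n k : n <> k ->
  L2 (cos_mode n) (cos_mode k) = 0 /\ L2 (sin_mode n) (sin_mode k) = 0.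
Proof.
  intro Hnk.
  pose proof (L2_cderiv_l (cos_mode n) (sin_mode k)) as H1.
  pose proof (L2_cderiv_l (sin_mode n) (cos_mode k)) as H2.
  rewrite cderiv_cos_mode, cderiv_sin_mode, L2_scal_l, L2_scal_r in H1, H2.
  set (C := L2 (cos_mode n) (cos_mode k)) in *.
  set (S := L2 (sin_mode n) (sin_mode k)) in *.
  assert (D : INR n * INR n - INR k * INR k <> 0).
  { intro E; apply Hnk, INR_eq; pose proof (pos_INR n); pose proof (pos_INR k).
    apply Rsqr_inj; unfold Rsqr; lra. }
  split; apply Rmult_eq_reg_l with (2 := D); rewrite Rmult_0_r.
  - replace ((INR n * INR n - INR k * INR k) * C)
      with (INR n * (INR n * C) - INR k * (INR k * C)) by ring.
    replace (INR n * C) with (INR k * S) by lra.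
    replace (INR k * C) with (INR n * S) by lra; ring.
  - replace ((INR n * INR n - INR k * INR k) * S)
      with (INR n * (INR n * S) - INR k * (INR k * S)) by ring.
    replace (INR n * S) with (INR k * C) by lra.
    replace (INR k * S) with (INR n * C) by lra; ring.
Qed.

(** * The equation for the inertia operator *)

(** The Euler equation in momentum form, [m_t = - (2 m u_x + u m_x)] with
    [m = A u].  Quantifying over [z] instead of writing [Linv] lets concrete
    instances be checked by applying [L] alone. *)
Lemma dp_euler_identity A u z : regular_inertia A -> dp_is_euler A ->
  Lop z = (3 *: (Lop u * cderiv u) + u * cderiv (Lop u))%cinf ->
  A z = (2 *: (A u * cderiv u) + u * cderiv (A u))%cinf.
Proof.
  intros rA E Hz.
  assert (Ez : z = ad_star A u u).
  { rewrite <- (Linv_Lop z), Hz; apply Cinf_ext; intro x.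
    pose proof (cinf_eq_at _ _ (E u) x) as Ex; cbn in Ex |- *; lra. }
  rewrite Ez; apply L2_inj; intro w.
  rewrite <- L2_ad; exact (ad_star_spec A u u rA w).
Qed.

Lemma inertia_zero A : regular_inertia A -> A czero = czero.
Proof.
  intros ((_ & scal) & _).
  replace czero with (0 *: czero)%cinf at 1 by (apply Cinf_ext; intro; cbn; ring).
  rewrite scal; apply Cinf_ext; intro; cbn; ring.
Qed.

(** Constants are stationary for the Degasperis-Procesi equation; for the Euler
    equation this makes [(A 1)_x] vanish. *)
Lemma inertia_one A : regular_inertia A -> dp_is_euler A ->
  exists c, c <> 0 /\ A one = (c *: one)%cinf.
Proof.
  intros rA E.
  assert (D : A czero = (2 *: (A one * cderiv one) + one * cderiv (A one))%cinf).
  { apply dp_euler_identity; [exact rA | exact E |].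
    unfold Lop at 1; rewrite Lop_one, cderiv_one; apply Cinf_ext; intro x; cbn.
    rewrite (Derive_ext (Derive (fun _ => 0)) (fun _ => 0)), Derive_const;
      [ring | intro; apply Derive_const]. }
  rewrite (inertia_zero A rA), cderiv_one in D.
  assert (Ec : A one = ((A one 0) *: one)%cinf).
  { apply Cinf_ext; intro x; cbn; rewrite Rmult_1_r.
    apply zero_derive_const; intro y.
    replace 0 with (cderiv (A one) y); [apply cinf_is_derive|].
    pose proof (cinf_eq_at _ _ D y) as Dy; cbn in Dy |- *; lra. }
  exists (A one 0); split; [|exact Ec].
  intro c0; rewrite c0 in Ec.
  assert (A0 : A one = A czero).
  { rewrite Ec, (inertia_zero A rA); apply Cinf_ext; intro; cbn; ring. }
  destruct rA as (_ & _ & bij & _), (bij (A czero)) as (w & _ & Hw).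
  assert (one0 : one = czero) by (rewrite <- (Hw one A0); now apply Hw).
  pose proof (cinf_eq_at _ _ one0 0) as H; cbn in H; lra.
Qed.

(** Both sides of [dp_euler_identity] are quadratic in [u], so subtracting the
    identity at [w] from the one at [1 + w] leaves the part linear in [w]. *)
Lemma dp_euler_linearised A c w y : regular_inertia A -> dp_is_euler A ->
  A one = (c *: one)%cinf ->
  Lop y = (3 *: cderiv w + cderiv (Lop w))%cinf ->
  A y = ((2 * c) *: cderiv w + cderiv (A w))%cinf.
Proof.
  intros rA E A1 Hy.
  set (z := Linv (3 *: (Lop w * cderiv w) + w * cderiv (Lop w))%cinf).
  assert (Hz : A z = (2 *: (A w * cderiv w) + w * cderiv (A w))%cinf).
  { apply dp_euler_identity; [exact rA | exact E | apply Lop_Linv]. }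
  assert (Hzy : A (z + y)%cinf =
    (2 *: (A (one + w) * cderiv (one + w))
     + (one + w) * cderiv (A (one + w)))%cinf).
  { apply dp_euler_identity; [exact rA | exact E |].
    rewrite !Lop_add, Hy; unfold z; rewrite Lop_Linv, Lop_one.
    rewrite !cderiv_add, cderiv_one; apply Cinf_ext; intro x.
    cbn -[Lop cderiv]; cbn [cfun czero]; ring. }
  destruct rA as ((add & _) & _).
  rewrite !add, Hz, A1, !cderiv_add, cderiv_scal, cderiv_one in Hzy.
  apply Cinf_ext; intro x; pose proof (cinf_eq_at _ _ Hzy x) as Hx.
  cbn in Hx |- *; lra.
Qed.

(** The matrix coefficients of [A] between modes of frequencies [n] and [k]:
    the linearised equation at [cos nx] paired with [sin kx], and at [sin nx]
    paired with [cos kx].  The factor [(4 + n^2) / (1 + n^2)] is the symbol of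
    [3 L^-1 + id]. *)
Lemma inertia_matrix A c n k : regular_inertia A -> dp_is_euler A ->
  A one = (c *: one)%cinf ->
  let r := (4 + INR n ^ 2) / (1 + INR n ^ 2) * INR n in
  let P := L2 (A (cos_mode n)) (cos_mode k) in
  let Q := L2 (A (sin_mode n)) (sin_mode k) in
  r * Q = INR k * P + 2 * c * INR n * L2 (sin_mode n) (sin_mode k) /\
  r * P = INR k * Q + 2 * c * INR n * L2 (cos_mode n) (cos_mode k).
Proof.
  intros rA E A1 r P Q.
  assert (pos : 1 + INR n ^ 2 <> 0) by (pose proof (pow2_ge_0 (INR n)); lra).
  assert (scal : forall a v, A (a *: v)%cinf = (a *: A v)%cinf) by apply rA.
  split.
  - assert (H : A ((- r) *: sin_mode n)%cinf =
      ((2 * c) *: cderiv (cos_mode n) + cderiv (A (cos_mode n)))%cinf).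
    { apply dp_euler_linearised; [exact rA | exact E | exact A1 |].
      rewrite Lop_scal, Lop_sin_mode, Lop_cos_mode, cderiv_scal, cderiv_cos_mode.
      apply Cinf_ext; intro x; unfold r; cbn -[INR pow]; now field. }
    apply (f_equal (fun v => L2 v (sin_mode k))) in H.
    rewrite scal, cderiv_cos_mode, L2_add_l, !L2_scal_l, L2_cderiv_l,
      cderiv_sin_mode, L2_scal_r in H.
    fold P Q in H; lra.
  - assert (H : A (r *: cos_mode n)%cinf =
      ((2 * c) *: cderiv (sin_mode n) + cderiv (A (sin_mode n)))%cinf).
    { apply dp_euler_linearised; [exact rA | exact E | exact A1 |].
      rewrite Lop_scal, Lop_sin_mode, Lop_cos_mode, cderiv_scal, cderiv_sin_mode.
      apply Cinf_ext; intro x; unfold r; cbn -[INR pow]; now field. }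
    apply (f_equal (fun v => L2 v (cos_mode k))) in H.
    rewrite scal, cderiv_sin_mode, L2_add_l, !L2_scal_l, L2_cderiv_l,
      cderiv_cos_mode, L2_scal_r in H.
    fold P Q in H; lra.
Qed.

(** * The contradiction at the first mode *)

Lemma ad_cos_mode_1_sin_mode_2 : ad (cos_mode 1) (sin_mode 2) =
  ((-3 / 2) *: cos_mode 1 + (-1 / 2) *: cos_mode 3)%cinf.
Proof.
  unfold ad; rewrite cderiv_cos_mode, cderiv_sin_mode.
  apply Cinf_ext; intro x; cbn.
  replace ((1 + 1 + 1) * x) with (2 * x + x) by ring.
  replace ((1 + 1) * x) with (2 * x) by ring.
  assert (E : cos x = cos (2 * x) * cos x + sin (2 * x) * sin x)
    by (rewrite <- cos_minus; f_equal; ring).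
  rewrite !Rmult_1_l, cos_plus; lra.
Qed.

Theorem corollary6 :
  ~ exists A : Cinf -> Cinf, regular_inertia A /\ dp_is_euler A.
Proof.
  intros (A & rA & E).
  destruct (inertia_one A rA E) as (c & c0 & A1).
  (* The pairing of the identity at cos x with sin 2x only involves these
     coefficients, because ad (cos x) (sin 2x) has frequencies 1 and 3.  Each
     system is nonsingular: the factor n (4 + n^2) / (1 + n^2) is 5/2 for n = 1
     and 16/5 for n = 2, and neither is the frequency k it is paired with. *)
  destruct (inertia_matrix A c 1 1 rA E A1) as (H11 & H11').
  destruct (inertia_matrix A c 1 3 rA E A1) as (H13 & H13').
  destruct (inertia_matrix A c 2 2 rA E A1) as (H22 & H22').
  destruct (L2_cos_sin_mode 0) as (N1 & N1').
  destruct (L2_cos_sin_mode 1) as (N2 & N2').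
  destruct (L2_modes_orthogonal 1 3) as (O & O'); [easy|].
  rewrite N1' in H11; rewrite N1 in H11'; rewrite O' in H13; rewrite O in H13';
    rewrite N2' in H22; rewrite N2 in H22'.
  (* For u = cos x: 3 (L u) u_x + u (L u)_x = 8 u u_x = -4 sin 2x, and L acts
     on sin 2x as multiplication by 5. *)
  assert (H : A ((-4 / 5) *: sin_mode 2)%cinf =
    (2 *: (A (cos_mode 1) * cderiv (cos_mode 1))
     + cos_mode 1 * cderiv (A (cos_mode 1)))%cinf).
  { apply dp_euler_identity; [exact rA | exact E |].
    rewrite Lop_scal, Lop_sin_mode, Lop_cos_mode, cderiv_scal, cderiv_cos_mode.
    apply Cinf_ext; intro x; cbn.
    replace ((1 + 1) * x) with (2 * x) by ring.
    rewrite sin_2a, !Rmult_1_l; field. }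
  apply (f_equal (fun v => L2 v (sin_mode 2))) in H.
  rewrite <- L2_ad, ad_cos_mode_1_sin_mode_2, L2_add_r, !L2_scal_r in H.
  rewrite (proj2 (proj1 rA)), L2_scal_l in H.
  cbn [INR] in *.
  assert (cPI : c * PI = 0) by lra.
  pose proof PI_RGT_0; destruct (Rmult_integral _ _ cPI); lra.
Qed.
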